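(* Let $\mathbb{X},\mathbb{Y}$ be real Hilbert spaces, let $T:D(T)\subset\mathbb{X}\to\mathbb{Y}$ be a (not necessarily linear) operator and let $f^\dagger\in D(T)$. Suppose there exists a family of orthogonal projections $P_r\in L(\mathbb{X})$ indexed by a parameter $r$ in some index set $\mathcal{J}$ such that for some functions $\kappa,\sigma:\mathcal{J}\to(0,\infty)$ and some $C\ge 0$ the following conditions hold for all $r\in\mathcal{J}$: $$\|f^\dagger-P_rf^\dagger\|_{\mathbb{X}}\le\kappa(r),$$ $$\langle f^\dagger,P_r(f^\dagger-f)\rangle_{\mathbb{X}}\le\sigma(r)\,\|T(f^\dagger)-T(f)\|_{\mathbb{Y}}+C\kappa(r)\,\|f^\dagger-f\|_{\mathbb{X}}\quad\text{for all } f\in D(T)\text{ with }\|f-f^\dagger\|_{\mathbb{X}}\le 4\|f^\dagger\|_{\mathbb{X}}.$$ Then $f^\dagger$ satisfies the variational source condition $$2\langle f^\dagger,f^\dagger-f\rangle_{\mathbb{X}}\le\tfrac12\|f-f^\dagger\|_{\mathbb{X}}^2+\psi\big(\|T(f)-T(f^\dagger)\|_{\mathbb{Y}}^2\big)\quad\text{for all } f\in D(T)$$ with $$\psi(t):=2\inf_{r\in\mathcal{J}}\Big[(C+1)^2\kappa(r)^2+\sigma(r)\sqrt t\Big],\qquad t\ge0.$$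
   Context: $L(\mathbb{X})$ denotes the bounded linear operators on $\mathbb{X}$. All norms and inner products are those of the Hilbert spaces $\mathbb{X}$ and $\mathbb{Y}$. *)

(* Defs.v *)
From HB Require Import structures.
From mathcomp Require Import all_boot all_order all_algebra.
From mathcomp Require Import all_classical all_reals all_analysis.

Set Implicit Arguments.
Unset Strict Implicit.
Unset Printing Implicit Defensive.

Import Order.TTheory GRing.Theory Num.Theory.
Import numFieldNormedType.Exports.

Local Open Scope classical_set_scope.
Local Open Scope ring_scope.

(* [{dot X for idfun}] is the type of symmetric positive definite bilinear
   forms on X; [dot_norm] says that the norm (hence also the topology and the
   completeness of X) is the one induced by the inner product. *)
HB.mixin Record isRealHilbert (R : realType) X
    of CompleteNormedModule R X := {
  dot : {dot X for (idfun : R -> R)} ;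
  dot_norm : forall x : X, dot x x = `|x| ^+ 2
}.

#[short(type="realHilbertType")]
HB.structure Definition RealHilbert (R : realType) :=
  {X of CompleteNormedModule R X & isRealHilbert R X}.

Declare Scope hilbert_scope.
Notation "''[' x , y ]" := (dot x%R y%R)
  (at level 0, format "''[' x ,  y ]") : hilbert_scope.
Open Scope hilbert_scope.

(* For a linear map, [bounded_near P (nbhs 0)] is boundedness in the operator
   norm: see [linear_boundedP] in normed_module. *)
Definition orthogonal_projection (R : realType) (X : realHilbertType R)
    (P : {linear X -> X}) : Prop :=
  [/\ bounded_near P (nbhs (0 : X)),
      forall x, P (P x) = P x
    & forall x y, '[P x, y] = '[x, P y]].

(* The partially defined operator T : D(T) -> Y is a function on the subtype
   associated with its domain D; [\val f] is f viewed as an element of X. *)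
Definition variational_source_condition (R : realType)
    (X Y : realHilbertType R) (D : set X) (T : D -> Y) (fdag : D)
    (psi : R -> \bar R) : Prop :=
  forall f : D,
    ((2 * '[\val fdag, \val fdag - \val f])%:E
     <= (2^-1 * `|\val f - \val fdag| ^+ 2)%:E
        + psi (`|T f - T fdag| ^+ 2)%R)%E.

(* The infimum is taken in the extended reals, so that it is +oo when the
   index set is empty. *)
Definition vsc_psi (R : realType) (J : Type) (kappa sigma : J -> R) (C t : R)
    : \bar R :=
  (2%:E * ereal_inf (range (fun r : J =>
     ((C + 1) ^+ 2 * kappa r ^+ 2 + sigma r * Num.sqrt t)%:E)))%E.

(* Main.v *)
(** Write h = f† - f. If |h| > 4|f†|, Cauchy-Schwarz alone gives
    2<f†, h> <= |h|^2 / 2, and psi >= 0. Otherwise, P r being self-adjoint,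
    <f†, h> = <f† - P r f†, h> + <f†, P r h>
           <= (C + 1) kappa(r) |h| + sigma(r) |T f† - T f|,
    and 2(C + 1) kappa(r) |h| <= |h|^2 / 2 + 2(C + 1)^2 kappa(r)^2 by Young's
    inequality; it remains to take the infimum over r. *)
Require Import Defs.
From mathcomp Require Import all_boot all_order all_algebra.
From mathcomp Require Import all_classical all_reals all_analysis.
From mathcomp Require Import lra.
Import Order.TTheory GRing.Theory Num.Theory.
Import numFieldNormedType.Exports.
Local Open Scope classical_set_scope.
Local Open Scope ring_scope.

Lemma dotC (R : realType) (X : realHilbertType R) (x y : X) : '[x, y] = '[y, x].
Proof. by rewrite hermC /= expr0 mul1r. Qed.

Lemma dotBl (R : realType) (X : realHilbertType R) (x y z : X) :
  '[x - y, z] = '[x, z] - '[y, z].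
Proof. exact: linearBl. Qed.

(* In this norm-first setting Cauchy-Schwarz is the squared triangle inequality. *)
Lemma dot_le_norm (R : realType) (X : realHilbertType R) (x y : X) :
  '[x, y] <= `|x| * `|y|.
Proof.
have : `|x + y| ^+ 2 <= (`|x| + `|y|) ^+ 2.
  by rewrite lerXn2r ?nnegrE ?addr_ge0 // ler_normD.
rewrite -dot_norm linearDl !linearDr /= !dot_norm (dotC _ _ y x) sqrrD.
lra.
Qed.

Theorem theorem2p1 (R : realType) (X Y : realHilbertType R)
  (D : set X) (T : D -> Y) (fdag : D)
  (J : Type) (P : J -> {linear X -> X}) (kappa sigma : J -> R) (C : R)
  (hP : forall r : J, orthogonal_projection (P r))
  (hkappa : forall r : J, 0 < kappa r)
  (hsigma : forall r : J, 0 < sigma r)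
  (hC : 0 <= C)
  (happrox : forall r : J, `|\val fdag - P r (\val fdag)| <= kappa r)
  (hcond : forall (r : J) (f : D),
     `|\val f - \val fdag| <= 4 * `|\val fdag| ->
     '[\val fdag, P r (\val fdag - \val f)]
       <= sigma r * `|T fdag - T f| + C * kappa r * `|\val fdag - \val f|) :
  variational_source_condition T fdag (vsc_psi kappa sigma C).
Proof.
move=> f; rewrite /vsc_psi sqrtr_sqr normr_id (distrC (T f)) (distrC (\val f)).
(* With the quadratic term moved left and the factor 2 divided out, the claim is that <f†, h> -
   |h|^2 / 4 is a lower bound of the family under the infimum; an empty [J] needs no separate
   case. *)
rewrite -leeBlDl // -lee_pdivrMl // -EFinB -EFinM.
apply: le_ereal_inf_tmp => _ [r _ <-]; rewrite lee_fin.
have := hcond r f; rewrite (distrC (\val f)).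
have := normr_ge0 (T fdag - T f).
move: (`|T fdag - T f|) => t t0.
set h := \val fdag - \val f => near_bound.
have h0 := normr_ge0 h; have k0 := hkappa r; have s0 := hsigma r.
have st0 : 0 <= sigma r * t by rewrite mulr_ge0 // ltW.
have [/near_bound le_proj|far] := leP `|h| (4 * `|\val fdag|).
  have le_compl : '[\val fdag - P r (\val fdag), h] <= kappa r * `|h|.
    by apply: le_trans (dot_le_norm _ _ _ _) _; rewrite ler_wpM2r.
  have [_ _ Psym] := hP r.
  move: le_compl; rewrite dotBl Psym.
  (* Expanded and divided by 4, this is Young's inequality with the constants needed here. *)
  have := sqr_ge0 (`|h| - 2 * ((C + 1) * kappa r)).
  rewrite -exprMn; nra.
have := dot_le_norm _ _ (\val fdag) h.
(* This is [far] multiplied by |h| / 4. *)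
have : `|\val fdag| * `|h| <= 4^-1 * `|h| ^+ 2 by nra.
have : 0 <= (C + 1) ^+ 2 * kappa r ^+ 2 by rewrite mulr_ge0 ?sqr_ge0.
lra.
Qed.
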